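(* Let $n>1$ and let $NC(10n+1,5)$ be the number of non-isomorphic cyclic $(K_{10n+1},C_5)$-designs. Then there is an integer $N$ such that for all $n\ge N$: - if $n\not\equiv 4\pmod 7$, then $NC(10n+1,5)\ge (29.7)^n$; - if $n\equiv 4\pmod 7$, then $NC(10n+1,5)\ge (38.4)^n$.
   Context: A $(K_v,C_k)$-design (or $k$-cycle system of the complete graph $K_v$) is a set $\mathcal{B}$ of $k$-cycles of $K_v$ whose edges partition the edge-set of $K_v$. It is cyclic if the vertex-set can be identified with $\mathbb{Z}_v$ in such a way that $B=(b_1,\dots,b_k)\in\mathcal{B}$ implies $B+z=(b_1+z,\dots,b_k+z)\in\mathcal{B}$ for all $z\in\mathbb{Z}_v$. Two $(K_v,C_k)$-designs with cycle sets $\mathcal{B}$ and $\mathcal{B}'$ are isomorphic if there is a permutation of the vertex-set turning $\mathcal{B}$ into $\mathcal{B}'$. $NC(v,k)$ is the number of cyclic $(K_v,C_k)$-designs up to isomorphism. *)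

(* Defs.v *)
From mathcomp Require Import all_boot all_order all_algebra all_fingroup.
Set Implicit Arguments.
Unset Strict Implicit.
Unset Printing Implicit Defensive.

(* A k-cycle (k >= 3) of a complete graph is a subgraph, hence is encoded by its
   set of edges, an edge being a two-element set of vertices. In this way the
   vertex sequences (b_1, ..., b_k) that differ by a rotation or a reflection
   denote the same cycle. *)

Definition complete_edges (V : finType) : {set {set V}} :=
  [set e : {set V} | #|e| == 2].

Definition cycle_edges (V : finType) (c : seq V) : {set {set V}} :=
  [set [set x; next c x] | x in c].

Definition is_kcycle (V : finType) (k : nat) (C : {set {set V}}) : bool :=
  (2 < k) && [exists c : k.-tuple V, uniq c && (C == cycle_edges c)].

Definition is_cycle_system (V : finType) (k : nat)
    (B : {set {set {set V}}}) : bool :=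
  [forall C in B, is_kcycle k C] && partition B (complete_edges V).

Definition map_cycle (V W : finType) (f : V -> W) (C : {set {set V}}) :
    {set {set W}} :=
  [set f @: e | e : {set V} in C].

Definition map_system (V W : finType) (f : V -> W) (B : {set {set {set V}}}) :
    {set {set {set W}}} :=
  [set map_cycle f C | C : {set {set V}} in B].

(* The bijection f identifies V with Z_v. Pitfall: 'Z_v is the ring of integers
   modulo v only when v > 1. *)
Definition is_cyclic (v : nat) (V : finType) (B : {set {set {set V}}}) : bool :=
  [exists f : {ffun V -> 'Z_v},
    [&& injectiveb f, [forall y : 'Z_v, y \in codom f] &
      [forall C in map_system f B, forall z : 'Z_v,
         map_cycle (fun x : 'Z_v => (x + z)%R) C \in map_system f B]]].

Definition isomorphic_systems (V : finType) (B B' : {set {set {set V}}}) : bool :=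
  [exists s : {perm V}, map_system s B == B'].

Definition cyclic_systems (v k : nat) : {set {set {set {set 'I_v}}}} :=
  [set B | is_cycle_system k B && is_cyclic v B].

Definition NC (v k : nat) : nat :=
  #|equivalence_partition (@isomorphic_systems 'I_v) (cyclic_systems v k)|.

(* Main.v *)
(* A cyclic 5-cycle system of K_v with v = 10n+1 arises from n base pentagons
   whose signed edge differences are exactly the nonzero residues mod v. Below,
   n-2 of the base pentagons consist of a triple of differences with signed sum 1
   together with a pair {p, p+1}, which has signed sum -1. Any matching of triples
   with pairs is admissible, and different matchings give different systems, so
   there are (n-2)! of them.
     All these systems contain the translates of the pentagon (0, 1, c, 2, 5). An
   automorphism fixing z and z+1 fixes the pentagon through that edge pointwise,
   hence fixes z+2, and inductively everything. Automorphisms are thus determined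
   by the images of 0 and 1, so at most v^3 of the (n-2)! systems are isomorphic
   to a given one, and (n-2)! / v^3 eventually exceeds 39^n. *)
Require Import Defs.
From mathcomp Require Import all_boot all_order all_algebra all_fingroup.
From mathcomp Require Import zify ring lra.
Import Order.TTheory GRing.Theory Num.Theory.
Set Implicit Arguments.
Unset Strict Implicit.
Unset Printing Implicit Defensive.
Local Open Scope ring_scope.

(** * Pentagon systems from difference families *)

Lemma set2_eq (V : finType) (a b c d : V) :
  [set a; b] = [set c; d] -> a = c /\ b = d \/ a = d /\ b = c.
Proof.
move=> E; have : a \in [set c; d] by rewrite -E set21.
have : b \in [set c; d] by rewrite -E set22.
have : c \in [set a; b] by rewrite E set21.
have : d \in [set a; b] by rewrite E set22.
rewrite !inE => /orP[]/eqP ? /orP[]/eqP ? /orP[]/eqP ? /orP[]/eqP ?;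
  by [left; split; congruence | right; split; congruence].
Qed.

Definition pentagon (V : finType) (f : 'Z_5 -> V) : {set {set V}} :=
  [set [set f j; f (j + 1)] | j : 'Z_5].

Lemma pentagon_kcycle (V : finType) (f : 'Z_5 -> V) :
  injective f -> is_kcycle 5 (pentagon f).
Proof.
move=> f_inj; pose s : seq 'Z_5 := [:: 0; 1; 2; 3; 4].
have s_all j : j \in s by case: j => [[|[|[|[|[|]]]]]].
have nextE j : next s j = j + 1.
  by apply/eqP; case: j => [[|[|[|[|[|]]]]]].
apply/existsP; exists [tuple of map f s].
rewrite map_inj_uniq //; apply/eqP/setP => e.
apply/imsetP/imsetP => [[j _ ->]|[x]].
  by exists (f j); rewrite ?map_f // next_map // nextE.
by move=> /mapP[j _ ->] ->; exists j; rewrite // next_map // nextE.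
Qed.

Lemma map_cycle_pentagon (V W : finType) (g : V -> W) (f : 'Z_5 -> V) :
  map_cycle g (pentagon f) = pentagon (g \o f).
Proof.
rewrite /map_cycle /pentagon -imset_comp.
by apply: eq_imset => j /=; rewrite imsetU !imset_set1.
Qed.

Lemma pentagon_neighbour (V : finType) (f : 'Z_5 -> V) (j : 'Z_5) (y : V) :
  injective f -> [set f j; y] \in pentagon f ->
  y = f (j + 1) \/ y = f (j - 1).
Proof.
move=> f_inj /imsetP[k _ /set2_eq[[/f_inj-> ->]|[/f_inj-> ->]]]; first by left.
by right; rewrite addrK.
Qed.

Definition edge_diff (I : finType) (G : finZmodType) (b : I -> 'Z_5 -> G) (i : I) (j : 'Z_5) : G :=
  b i (j + 1) - b i j.

Definition develop (I : finType) (G : finZmodType) (b : I -> 'Z_5 -> G) :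
    {set {set {set G}}} :=
  [set pentagon (fun j => b p.1 j + p.2) | p : I * G].

Definition signed_diff (I : finType) (G : finZmodType) (b : I -> 'Z_5 -> G)
    (t : I * 'Z_5 * bool) : G :=
  if t.2 then - edge_diff b t.1.1 t.1.2 else edge_diff b t.1.1 t.1.2.

(** Covering suffices: there are 10 triples (block, edge, sign) per block, as many in all as nonzero
    elements of [G], so a covering [signed_diff] is a bijection onto them. *)
Definition difference_family (I : finType) (G : finZmodType) (b : I -> 'Z_5 -> G) : Prop :=
  #|G| = (10 * #|I|).+1 /\ forall d : G, d != 0 -> exists t, d = signed_diff b t.

Lemma signed_diff_image (I : finType) (G : finZmodType) (b : I -> 'Z_5 -> G) :
  difference_family b -> signed_diff b @: setT = [set~ 0].
Proof.
case=> cardG cov; apply/esym/eqP; rewrite eqEcard; apply/andP; split.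
  apply/subsetP => d; rewrite !inE => /cov[t ->]; exact: imset_f.
rewrite cardsC1 cardG /= (leq_trans (leq_imset_card _ _)) //.
by rewrite cardsT !card_prod card_bool (card_ord 5) -mulnA mulnC.
Qed.

Lemma signed_diff_inj (I : finType) (G : finZmodType) (b : I -> 'Z_5 -> G) :
  difference_family b -> injective (signed_diff b).
Proof.
move=> bP; case: (bP) => cardG _ s t; apply: (imset_injP _) => //.
by rewrite signed_diff_image // cardsC1 cardG cardsT !card_prod card_bool (card_ord 5) -mulnA mulnC.
Qed.

Lemma signed_diff_neq0 (I : finType) (G : finZmodType) (b : I -> 'Z_5 -> G) t :
  difference_family b -> signed_diff b t != 0.
Proof.
move=> bP.
by have := imset_f (signed_diff b) (in_setT t); rewrite signed_diff_image // !inE.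
Qed.

(** Distinct indices in ['Z_5] are one or two steps apart. One step: edge differences are nonzero.
    Two steps: a coincidence would make an edge difference the negative of the next, against
    [signed_diff_inj]. *)
Lemma base_block_inj (I : finType) (G : finZmodType) (b : I -> 'Z_5 -> G) i :
  difference_family b -> injective (b i).
Proof.
move=> bP.
have n1 j : b i (j + 1) != b i j.
  by rewrite -subr_eq0; exact: (signed_diff_neq0 (i, j, false) bP).
have n2 j : b i (j + 1 + 1) != b i j.
  apply/negP => /eqP E.
  have := @signed_diff_inj _ _ _ bP (i, j, false) (i, j + 1, true).
  by rewrite /signed_diff /edge_diff /= E opprB => /(_ erefl).
move=> j k E.
have : [|| k == j, k == j + 1, k == j + 1 + 1, j == k + 1 | j == k + 1 + 1].
  by case: j {E} => [[|[|[|[|[|]]]]]] //; case: k => [[|[|[|[|[|]]]]]].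
by case/or4P => [/eqP//|/eqP h|/eqP h|/orP[]/eqP h]; move: (n1 j) (n2 j) (n1 k) (n2 k);
  rewrite -h E eqxx // -?E.
Qed.

Lemma shift_base_block_inj (I : finType) (G : finZmodType) (b : I -> 'Z_5 -> G) i z :
  difference_family b -> injective (fun j => b i j + z).
Proof. by move=> bP j k /addIr/(base_block_inj bP). Qed.

Lemma edge_in_shift (I : finType) (G : finZmodType) (b : I -> 'Z_5 -> G) i z p q :
  [set p; q] \in pentagon (fun j => b i j + z) ->
  exists2 t, t.1.1 = i & q - p = signed_diff b t /\
    if t.2 then q = b i t.1.2 + z else p = b i t.1.2 + z.
Proof.
case/imsetP => j _ /set2_eq[[-> ->]|[-> ->]].
  by exists (i, j, false) => //; rewrite /signed_diff /edge_diff /= opprD addrACA subrr addr0.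
by exists (i, j, true) => //; rewrite /signed_diff /edge_diff /= opprB opprD addrACA subrr addr0.
Qed.

(** Orient the common edge. Its difference determines the base block, the edge in it and the sign;
    an endpoint then determines the translation. *)
Lemma develop_unique (I : finType) (G : finZmodType) (b : I -> 'Z_5 -> G) C C' e :
  difference_family b ->
  C \in develop b -> C' \in develop b -> e \in C -> e \in C' -> C = C'.
Proof.
move=> bP /imsetP[[i z] _ ->] /imsetP[[i' z'] _ ->] /= eC.
have [j _ ej] := imsetP eC; rewrite ej in eC * => eC'.
have [t it [dt ht]] := edge_in_shift eC.
have [t' it' [dt' ht']] := edge_in_shift eC'.
have tt' : t = t' by apply: (signed_diff_inj bP); rewrite -dt -dt'.
rewrite -tt' in ht' it'; rewrite -it -it' in ht ht' *; congr pentagon.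
suff -> : z = z' by [].
by move: ht ht'; case: ifP => _ -> /addrI.
Qed.

Lemma develop_cover (I : finType) (G : finZmodType) (b : I -> 'Z_5 -> G) p q :
  difference_family b -> p != q ->
  exists2 C, C \in develop b & [set p; q] \in C.
Proof.
move=> bP npq; have [|[[i j] s] /= E] := (proj2 bP (q - p)).
  by rewrite subr_eq0 eq_sym.
exists (pentagon (fun k => b i k + ((if s then q else p) - b i j))).
  by apply/imsetP; exists (i, (if s then q else p) - b i j).
apply/imsetP; exists j => //.
move: E; rewrite /signed_diff /edge_diff /=.
rewrite [b i j + _]addrC subrK addrCA; case: s => [/eqP|<-]; last by rewrite addrC subrK.
by rewrite -eqr_oppLR => /eqP <-; rewrite opprB addrC subrK setUC.
Qed.

Lemma develop_cycle_system (I : finType) (G : finZmodType) (b : I -> 'Z_5 -> G) :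
  difference_family b -> is_cycle_system 5 (develop b).
Proof.
move=> bP; apply/andP; split.
  apply/forall_inP => C /imsetP[[i z] _ ->].
  exact/pentagon_kcycle/shift_base_block_inj.
apply/and3P; split.
- apply/eqP/setP => e; apply/bigcupP/idP => [[C /imsetP[[i z] _ ->] /imsetP[j _ ->]]|].
    rewrite inE cards2 (inj_eq (@addIr _ _)) (inj_eq (@base_block_inj _ _ _ i bP)).
    by rewrite -[X in X != _]addr0 (inj_eq (addrI _)).
  rewrite inE => /cards2P[p [q [npq ->]]].
  by have [C CB eC] := develop_cover bP npq; exists C.
- apply/trivIsetP => C C' CB C'B; apply: contraR => /pred0Pn[e /andP[eC eC']].
  by apply/eqP; exact: (develop_unique bP CB C'B eC eC').
- apply/negP => /imsetP[[i z] _ /esym/eqP]; apply/negP/set0Pn.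
  by exists [set b i 0 + z; b i (0 + 1) + z]; apply/imsetP; exists 0.
Qed.

Lemma develop_translate (I : finType) (G : finZmodType) (b : I -> 'Z_5 -> G) C z :
  C \in develop b -> map_cycle (fun x => x + z) C \in develop b.
Proof.
case/imsetP => -[i y] _ ->; rewrite map_cycle_pentagon.
apply/imsetP; exists (i, y + z) => //.
by apply: eq_imset => j /=; rewrite !addrA.
Qed.

(** * Isomorphism classes of rigid cyclic systems *)

Lemma map_cycle_comp (U V W : finType) (g : V -> W) (f : U -> V) C :
  map_cycle g (map_cycle f C) = map_cycle (g \o f) C.
Proof.
by rewrite /map_cycle -imset_comp; apply: eq_imset => e /=; rewrite -imset_comp.
Qed.

Lemma map_cycle_id (V : finType) (f : V -> V) C : f =1 id -> map_cycle f C = C.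
Proof.
move=> fid; rewrite /map_cycle -[RHS]imset_id; apply: eq_imset => e.
by rewrite -[RHS]imset_id; apply: eq_imset.
Qed.

Lemma map_system_comp (U V W : finType) (g : V -> W) (f : U -> V) B :
  map_system g (map_system f B) = map_system (g \o f) B.
Proof.
by rewrite /map_system -imset_comp; apply: eq_imset => C /=; rewrite map_cycle_comp.
Qed.

Lemma map_system_id (V : finType) (f : V -> V) B : f =1 id -> map_system f B = B.
Proof.
move=> fid; rewrite /map_system -[RHS]imset_id; apply: eq_imset => C.
exact: map_cycle_id.
Qed.

Lemma eq_map_system (V W : finType) (f g : V -> W) B :
  f =1 g -> map_system f B = map_system g B.
Proof.
move=> fg; apply: eq_imset => C; apply: eq_imset => e; exact: eq_imset.
Qed.

(** The pentagon and its image share a fixed edge, so they coincide. The image of the next vertex is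
    then a neighbour of [f (j + 1)], and the other neighbour [f j] is already the image of
    itself. *)
Lemma automorphism_fixes_next (V : finType) (B : {set {set {set V}}}) f j (s : {perm V}) :
  is_cycle_system 5 B -> injective f -> pentagon f \in B ->
  map_system s B = B -> s (f j) = f j -> s (f (j + 1)) = f (j + 1) ->
  s (f (j + 1 + 1)) = f (j + 1 + 1).
Proof.
case/andP => _ /and3P[_ /trivIsetP tiB _] f_inj fB sB sj sj1.
have eC : [set f j; f (j + 1)] \in pentagon f by apply: imset_f.
have sC : map_cycle s (pentagon f) = pentagon f.
  apply/eqP/negPn/negP => /(tiB _ _ _ fB).
  rewrite -{1}sB imset_f // => /(_ isT)/pred0P/(_ [set f j; f (j + 1)]) /=.
  rewrite eC andbT map_cycle_pentagon => /negP; apply.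
  by apply/imsetP; exists j; rewrite //= sj sj1.
have : [set f (j + 1); s (f (j + 1 + 1))] \in pentagon f.
  by rewrite -sC map_cycle_pentagon; apply/imsetP; exists (j + 1); rewrite //= sj1.
case/(pentagon_neighbour f_inj) => //.
rewrite addrK -sj => /perm_inj/f_inj/eqP.
by case: j {sj sj1 eC} => [[|[|[|[|[|]]]]]].
Qed.

Lemma automorphism_fixes_block (V : finType) (B : {set {set {set V}}}) f (s : {perm V}) :
  is_cycle_system 5 B -> injective f -> pentagon f \in B ->
  map_system s B = B -> s (f 0) = f 0 -> s (f 1) = f 1 ->
  forall j, s (f j) = f j.
Proof.
move=> Bsys f_inj fB sB s0 s1.
have step (i j k : 'Z_5) : val (i + 1) = val j -> val (j + 1) = val k ->
    s (f i) = f i -> s (f j) = f j -> s (f k) = f k.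
  move=> /val_inj <- /val_inj <-; exact: automorphism_fixes_next Bsys f_inj fB sB.
have s2 : s (f 2) = f 2 by apply: (step 0 1).
have s3 : s (f 3) = f 3 by apply: (step 1 2).
have s4 : s (f 4) = f 4 by apply: (step 2 3).
have same (i j : 'Z_5) : val i = val j -> s (f i) = f i -> s (f j) = f j.
  by move=> /val_inj->.
case=> [[|[|[|[|[|]]]]]] // i;
 [exact: same s0 | exact: same s1 | exact: same s2 | exact: same s3 | exact: same s4].
Qed.

(** Positions 0, 1 and 3 hold x, x+1 and x+2: an edge and a further vertex, which lets fixed points
    propagate by one. *)
Definition rigid_system (v : nat) (f : 'Z_5 -> 'Z_v) (B : {set {set {set 'Z_v}}}) : Prop :=
  [/\ is_cycle_system 5 B,
      forall C z, C \in B -> map_cycle (fun x => x + z) C \in B,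
      injective f & pentagon f \in B] /\
  f 1 = f 0 + 1 /\ f 3%:R = f 0 + 2.

Lemma rigid_automorphism_id (v : nat) f (B : {set {set {set 'Z_v}}}) (s : {perm 'Z_v}) :
  rigid_system f B -> map_system s B = B -> s 0 = 0 -> s 1 = 1 -> s =1 id.
Proof.
case=> -[Bsys Btr f_inj fB] [f1 f3] sB s0 s1.
have fixes k : s k%:R = k%:R /\ s k.+1%:R = k.+1%:R.
  elim: k => [|k [IHk IHk1]]; first by rewrite s0 s1.
  (* The translate of the rigid pentagon with [k] at position 0 has k+1 and k+2 at positions 1 and
     3. *)
  split=> //; pose g j := f j + (k%:R - f 0).
  have g0 : g 0 = k%:R by rewrite /g addrC subrK.
  have g1 : g 1 = k.+1%:R by rewrite /g f1 -natr1; ring.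
  have g3 : g 3%:R = k.+2%:R by rewrite /g f3 -!natr1; ring.
  rewrite -g3; apply: (@automorphism_fixes_block _ B) => //; rewrite ?g0 ?g1 //.
    by move=> i j /addIr/f_inj.
  by have := Btr _ (k%:R - f 0) fB; rewrite map_cycle_pentagon.
by move=> x; rewrite -[x]natr_Zp; case: (fixes x).
Qed.

Lemma rigid_automorphism_inj (v : nat) f (B : {set {set {set 'Z_v}}}) (s t : {perm 'Z_v}) :
  rigid_system f B -> map_system s B = B -> map_system t B = B ->
  s 0 = t 0 -> s 1 = t 1 -> s = t.
Proof.
move=> rB sB tB e0 e1; apply/permP => x.
have h : (s * t^-1)%g =1 id.
  apply: (rigid_automorphism_id rB); rewrite ?permM ?e0 ?e1 ?permK //.
  rewrite (@eq_map_system _ _ _ (t^-1%g \o s)) => [|y]; last by rewrite permM.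
  rewrite -map_system_comp sB -{1}tB map_system_comp.
  by apply: map_system_id => y /=; rewrite permK.
by rewrite -[in RHS](h x) permM permKV.
Qed.

Definition succ_perm (v : nat) : {perm 'Z_v} := perm (@addIr 'Z_v 1).

(* If s carries B to a translation-invariant system, the translation by 1
   conjugated by s is an automorphism of B. It is determined by its values at 0
   and 1, and together with s 0 it determines s. *)
Lemma rigid_isomorphism_inj (v : nat) f g h
    (B B1 B2 : {set {set {set 'Z_v}}}) (s t : {perm 'Z_v}) :
  rigid_system f B -> rigid_system g B1 -> rigid_system h B2 ->
  map_system s B = B1 -> map_system t B = B2 -> s 0 = t 0 ->
  (s * succ_perm v * s^-1)%g 0 = (t * succ_perm v * t^-1)%g 0 ->
  (s * succ_perm v * s^-1)%g 1 = (t * succ_perm v * t^-1)%g 1 ->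
  s = t.
Proof.
move=> rB rB1 rB2 sB tB e0 c0 c1.
have aut k (B' : {set {set {set 'Z_v}}}) (r : {perm 'Z_v}) : rigid_system k B' ->
    map_system r B = B' -> map_system (r * succ_perm v * r^-1)%g B = B.
  case=> -[_ tr _ _] _ rBE.
  have tB' : map_system (succ_perm v) B' = B'.
    apply/eqP; rewrite eqEsubset; apply/andP; split; apply/subsetP => C.
      case/imsetP => D DB ->; have := tr D 1 DB; congr (_ \in B').
      by apply: eq_imset => e; apply: eq_imset => x; rewrite permE.
    move=> CB; apply/imsetP; exists (map_cycle (fun x => x + -1) C); first exact: tr.
    by rewrite map_cycle_comp map_cycle_id // => x /=; rewrite permE subrK.
  rewrite (@eq_map_system _ _ _ (r^-1%g \o (succ_perm v \o r))) => [|y].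
    rewrite -(map_system_comp _ (succ_perm v \o r)) -(map_system_comp _ r) rBE tB' -rBE map_system_comp.
    by apply: map_system_id => y /=; rewrite permK.
  by rewrite !permM.
have E := rigid_automorphism_inj rB (aut _ _ _ rB1 sB) (aut _ _ _ rB2 tB) c0 c1.
have conjE (r : {perm 'Z_v}) k :
    r (iter k (r * succ_perm v * r^-1)%g 0) = r 0 + k%:R.
  elim: k => [|k IHk]; first by rewrite addr0.
  by rewrite iterS !permM permKV permE IHk -natr1 addrA.
apply/permP => x.
have := conjE s (s x - s 0 : 'Z_v); rewrite natr_Zp [s 0 + _]addrC subrK => /perm_inj xE.
have := conjE t (s x - s 0 : 'Z_v).
by rewrite -E xE natr_Zp -e0 [s 0 + _]addrC subrK.
Qed.

(** Choose one isomorphism from [B] to each member of its class. By [rigid_isomorphism_inj] it is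
    determined by three elements of ['Z_v], and it determines its target. *)
Lemma rigid_class_bound (v : nat) f (F : {set {set {set {set 'Z_v}}}}) B :
  (forall D, D \in F -> rigid_system f D) -> B \in F ->
  (#|[set D in F | isomorphic_systems B D]| <= #|'Z_v| ^ 3)%N.
Proof.
move=> rF BF; set X := [set D in F | _].
(* For [D] in [X] an isomorphism exists, so the default [1%g] is never taken. *)
pose s D : {perm 'Z_v} := odflt 1%g [pick s : {perm 'Z_v} | map_system s B == D].
have sP D : D \in X -> map_system (s D) B = D.
  rewrite inE /s => /andP[_ /existsP[t tP]].
  by case: pickP => [r /eqP //|/(_ t)]; rewrite tP.
pose c D := (s D * succ_perm v * (s D)^-1)%g.
have c_inj : {in X &, injective (fun D => (s D 0, c D 0, c D 1))}.
  move=> D1 D2 D1X D2X [e0 c0 c1]; rewrite -(sP D1) // -(sP D2) //.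
  have [[D1F _] [D2F _]] : (D1 \in F /\ true) /\ (D2 \in F /\ true).
    by move: D1X D2X; rewrite !inE => /andP[-> _] /andP[-> _].
  by rewrite (rigid_isomorphism_inj (rF _ BF) (rF _ D1F) (rF _ D2F) (sP _ D1X) (sP _ D2X)).
rewrite -(card_in_imset c_inj) (leq_trans (max_card _)) //.
by rewrite !card_prod !expnS expn0 muln1 mulnA.
Qed.

(** Count [F] along the fibres of the class map [cl]. Writing the order as [u.+2] makes ['Z_u.+2]
    convertible to ['I_u.+2], so the identity serves as the identification with the cyclic group. *)
Lemma rigid_systems_NC (u : nat) f (F : {set {set {set {set 'Z_u.+2}}}}) :
  (forall D, D \in F -> rigid_system f D) ->
  (#|F| <= NC u.+2 5 * u.+2 ^ 3)%N.
Proof.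
move=> rF; set S := cyclic_systems u.+2 5.
have FS D : D \in F -> D \in S.
  move=> DF; have [[Dsys Dtr _ _] _] := rF D DF.
  rewrite inE Dsys /=; apply/existsP; exists [ffun x => x].
  have DE : map_system [ffun x : 'Z_u.+2 => x] D = D.
    by apply: map_system_id => x; rewrite ffunE.
  apply/and3P; split.
  - by apply/injectiveP => x y; rewrite !ffunE.
  - by apply/forallP => y; apply/codomP; exists y; rewrite ffunE.
  - by rewrite DE; apply/forall_inP => C CD; apply/forallP => z; apply: Dtr.
pose cl D := [set E in S | isomorphic_systems D E].
have refl D : isomorphic_systems D D.
  by apply/existsP; exists 1%g; apply/eqP/map_system_id => x; rewrite perm1.
have clNC : (#|cl @: F| <= NC u.+2 5)%N.
  by apply/subset_leq_card/subsetP => _ /imsetP[D DF ->]; apply: imset_f; exact: FS.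
rewrite -sum1_card (partition_big_imset cl) /=.
apply: leq_trans (leq_mul clNC (leqnn _)); rewrite -sum_nat_const.
apply: leq_sum => _ /imsetP[D DF ->]; rewrite sum1dep_card.
have := rigid_class_bound rF DF; rewrite card_ord; apply: leq_trans.
apply/subset_leq_card/subsetP => E; rewrite !inE => /andP[EF /eqP clE]; rewrite EF /=.
(* Reflexivity puts [E] in its own class, which is the class of [D]. *)
have : E \in cl E by rewrite inE refl FS.
by rewrite clE inE => /andP[].
Qed.

(** * An explicit difference family *)

(* Writing g = floor((n+1)/2), c = even_center n, C = odd_center n, the set
   {1, ..., 5n} is split as follows.
   - rigid block: 1, 3, 5, c-1, c-2;
   - special block: 2, c, C, C+1 and gap n; the signed sum is 0 for g even and the
     sum is 10n+1 for g odd;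
   - triples x = small_diff i, y = left_diff n i, y + x - 1, where x runs through
     {4} and {6, ..., n+2}, and y, y + x - 1 are nested around c (x odd) or around
     C + 1/2 (x even);
   - pairs p, p+1: one is {c+1, c+2}, the others are the consecutive pairs in
     {3n+6, ..., 5n} once gap n is deleted. *)
Definition even_center (n : nat) : nat := (n + (n.+1)./2 + 3)%N.
Definition odd_center (n : nat) : nat := (2 * n + (n.+1)./2 + 4)%N.
Definition gap (n : nat) : nat :=
  if odd (n.+1)./2 then (5 * n - 3 * (n.+1)./2 - 13)%N else (3 * n + (n.+1)./2 + 4)%N.
Definition small_diff (i : nat) : nat := if i == 0%N then 4%N else (i + 5)%N.
Definition left_diff (n i : nat) : nat :=
  ((if odd (small_diff i) then even_center n else odd_center n) - (small_diff i).-1./2)%N.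
Definition pair_diff (n j : nat) : nat :=
  if j == 0%N then (even_center n).+1
  else let q := (3 * n + 2 * j + 4)%N in if (q < gap n)%N then q else q.+1.

Lemma diff_cover (n d : nat) : (38 <= n)%N -> (0 < d <= 5 * n)%N ->
  [\/ d \in [:: 1; even_center n - 1; even_center n - 2; 3; 5]%N,
      d \in [:: 2; even_center n; gap n; odd_center n; (odd_center n).+1]%N,
      exists i : 'I_(n - 2), d \in [:: small_diff i; left_diff n i; left_diff n i + small_diff i - 1]%N
    | exists j : 'I_(n - 2), d \in [:: pair_diff n j; (pair_diff n j).+1]].
Proof.
move=> hn hd.
have tri i : (i < n - 2)%N ->
    [|| d == small_diff i, d == left_diff n i | d == (left_diff n i + small_diff i - 1)%N] ->
    exists i : 'I_(n - 2), d \in [:: small_diff i; left_diff n i; left_diff n i + small_diff i - 1]%N.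
  by move=> hi h; exists (Ordinal hi); rewrite !inE.
have pai i : (i < n - 2)%N ->
    (d == pair_diff n i) || (d == (pair_diff n i).+1) ->
    exists j : 'I_(n - 2), d \in [:: pair_diff n j; (pair_diff n j).+1].
  by move=> hi h; exists (Ordinal hi); rewrite !inE.
have [/orP[?|?]|/norP[h1 h2]] := boolP ((d \in [:: 1; even_center n - 1; even_center n - 2; 3; 5])%N
  || (d \in [:: 2; even_center n; gap n; odd_center n; (odd_center n).+1])%N).
  exact: Or41.
  exact: Or42.
have [g gE hg] : exists2 g, (n.+1)./2 = g & (n = 2 * g - 1 \/ n = 2 * g)%N.
  by exists (n.+1)./2; lia.
have cE : even_center n = (n + g + 3)%N by rewrite /even_center gE.
have cO : odd_center n = (2 * n + g + 4)%N by rewrite /odd_center gE.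
(* Triples are indexed by a radius r: x = 2r+2 goes with C-r and C+r+1, x = 2r+1 with c-r and c+r.
   Radius 0 at C and radii 0, 1, 2 at c are used up by the other blocks and the pair {c+1, c+2}. *)
have small_even r : (0 < r)%N -> small_diff (if r == 1%N then 0 else 2 * r - 3)%N = (2 * r + 2)%N.
  by move=> r0; rewrite /small_diff; case: ifP; case: ifP; lia.
have small_odd r : (2 < r)%N -> small_diff (2 * r - 4)%N = (2 * r + 1)%N.
  by move=> r0; rewrite /small_diff; case: ifP; lia.
have even_tri r : (0 < r)%N -> (2 * r <= n)%N ->
    [|| d == (2 * r + 2)%N, d == (odd_center n - r)%N | d == (odd_center n + r + 1)%N] ->
    exists i : 'I_(n - 2), d \in [:: small_diff i; left_diff n i; left_diff n i + small_diff i - 1]%N.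
  move=> r0 rn h; apply: (tri (if r == 1%N then 0 else 2 * r - 3)%N).
    by case: ifP; lia.
  rewrite /left_diff small_even // (_ : odd (2 * r + 2)%N = false); last by lia.
  by rewrite (_ : (2 * r + 2).-1./2 = r)%N; lia.
have odd_tri r : (2 < r)%N -> (2 * r < n + 2)%N ->
    [|| d == (2 * r + 1)%N, d == (even_center n - r)%N | d == (even_center n + r)%N] ->
    exists i : 'I_(n - 2), d \in [:: small_diff i; left_diff n i; left_diff n i + small_diff i - 1]%N.
  move=> r0 rn h; apply: (tri (2 * r - 4)%N); first by lia.
  rewrite /left_diff small_odd // (_ : odd (2 * r + 1)%N = true); last by lia.
  by rewrite (_ : (2 * r + 1).-1./2 = r)%N; lia.
move: h1 h2; rewrite !inE !negb_or cE cO.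
move=> /and5P[/eqP d1 /eqP dc1 /eqP dc2 /eqP d3 /eqP d5].
move=> /and5P[/eqP d2 /eqP dc /eqP dgap /eqP dC /eqP dC1].
(* The successive intervals ending at n+2, n+3+2g, 3n+5 and 5n contain the values x, the values
   around c, those around C + 1/2, and the consecutive pairs. *)
have [dK|Kd] := leqP d (n + 2).
  clear dc1 dc2 dc dgap dC dC1; have [od|ed] := boolP (odd d).
    by apply: Or43; apply: (odd_tri d./2); [lia | lia | apply/or3P/Or31; lia].
  by apply: Or43; apply: (even_tri (d./2 - 1)%N); [lia | lia | apply/or3P/Or31; lia].
clear d1 d2 d3 d5; have [d1|d1] := leqP d (n + 3 + 2 * g).
  clear dgap dC dC1; have [d2|d2] := leqP d (n + g + 3).
    apply: Or43; apply: (odd_tri (n + g + 3 - d)%N); [lia | lia |].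
    by apply/or3P/Or32; rewrite cE; lia.
  have [d3|d3] := leqP d (n + g + 5).
    by apply: Or44; apply: (pai 0%N); rewrite /pair_diff /= ?cE; lia.
  apply: Or43; apply: (odd_tri (d - (n + g + 3))%N); [lia | lia |].
  by apply/or3P/Or33; rewrite cE; lia.
clear dc1 dc2 dc; have [d2|d2] := leqP d (3 * n + 5).
  clear dgap; have [d3|d3] := leqP d (2 * n + g + 4).
    apply: Or43; apply: (even_tri (2 * n + g + 4 - d)%N); [lia | lia |].
    by apply/or3P/Or32; rewrite cO; lia.
  apply: Or43; apply: (even_tri (d - (2 * n + g + 5))%N); [lia | lia |].
  by apply/or3P/Or33; rewrite cO; lia.
(* The gap is 3n+6 plus an even number, so consecutive pairs fill both sides of it. For odd g the
   bound 38 is sharp here: k is 0 at n = 37. *)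
have [k kE hk] : exists2 k, gap n = (3 * n + 2 * k + 4)%N & (0 < k)%N && (2 * k < 2 * n - 5)%N.
  rewrite /gap gE; case: ifP => og.
    by exists (n - 3 * g./2 - 10)%N; lia.
  by exists g./2; lia.
rewrite kE in dgap; clear dC dC1 hg gE cE cO.
apply: Or44; have [dw|dw] := ltnP d (3 * n + 2 * k + 4).
  apply: (pai (d - (3 * n + 4))./2%N); first by lia.
  by rewrite /pair_diff kE ifF ?ifT; lia.
apply: (pai (d - (3 * n + 5))./2%N); first by lia.
by rewrite /pair_diff kE ifF ?ifF; lia.
Qed.

(** The differences [C] and [C+1] of the special block carry the opposite of this sign, which makes
    its signed differences add up to 0 modulo 10n+1. *)
Definition gap_sign (R : pzRingType) (n : nat) : R := (-1) ^+ odd (n.+1)./2.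

(** Vertices are partial sums of signed differences. Each [inl] block has fourth vertex 1, whatever
    its triple, so any pair closes it by p and -(p+1). *)
Definition base_blocks (n v : nat) (pi : {perm 'I_(n - 2)})
    (i : 'I_(n - 2) + bool) (j : 'Z_5) : 'Z_v :=
  match i with
  | inl i =>
    let x := (small_diff i)%:R in let y := (left_diff n i)%:R in
    nth 0 [:: 0; x; x + y; 1; 1 + (pair_diff n (pi i))%:R] j
  | inr true => nth 0 [:: 0; 1; (even_center n)%:R; 2; 5] j
  | inr false =>
    let c := (even_center n)%:R in let C := (odd_center n)%:R in
    nth 0 [:: 0; 2; 2 + c; gap_sign _ n * (2 * C + 1); gap_sign _ n * (C + 1)] j
  end.

Lemma exchange_diff (n v : nat) (pi : {perm 'I_(n - 2)}) (i : 'I_(n - 2)) j :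
  let x : 'Z_v := (small_diff i)%:R in let y := (left_diff n i)%:R in
  let p : 'Z_v := (pair_diff n (pi i))%:R in
  edge_diff (base_blocks v pi) (inl i) j = nth 0 [:: x; y; 1 - x - y; p; - 1 - p] j.
Proof.
by case: j => [[|[|[|[|[|]]]]]] // ?; rewrite /edge_diff /=; ring.
Qed.

Lemma rigid_diff (n v : nat) (pi : {perm 'I_(n - 2)}) j :
  let c : 'Z_v := (even_center n)%:R in
  edge_diff (base_blocks v pi) (inr true) j = nth 0 [:: 1; c - 1; 2 - c; 3; - 5] j.
Proof.
by case: j => [[|[|[|[|[|]]]]]] // ?; rewrite /edge_diff /=; ring.
Qed.

Lemma gap_sum (n v : nat) : (38 <= n)%N -> v = (10 * n + 1)%N ->
  2 + (even_center n)%:R + (gap n)%:R =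
    gap_sign 'Z_v n * (2 * (odd_center n)%:R + 1).
Proof.
move=> hn vE; rewrite /gap_sign.
have [og|eg] := boolP (odd (n.+1)./2).
  rewrite expr1 mulN1r; apply/eqP; rewrite -addr_eq0 -natrM natr1 -!natrD.
  rewrite (_ : _ + _ = v)%N ?pchar_Zp //; first by lia.
  by rewrite vE /gap og /even_center /odd_center; lia.
rewrite expr0 mul1r -natrM natr1 -!natrD; congr _%:R.
by rewrite /gap (negbTE eg) /even_center /odd_center; lia.
Qed.

Lemma special_diff (n v : nat) (pi : {perm 'I_(n - 2)}) j :
  (38 <= n)%N -> v = (10 * n + 1)%N ->
  let C : 'Z_v := (odd_center n)%:R in
  edge_diff (base_blocks v pi) (inr false) j =
  nth 0 [:: 2; (even_center n)%:R; (gap n)%:R; - (gap_sign _ n * C); - (gap_sign _ n * (C + 1))] j.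
Proof.
move=> hn vE C; have := gap_sum hn vE; rewrite -/C => E.
have gE : (gap n)%:R = gap_sign 'Z_v n * (2 * C + 1) - (2 + (even_center n)%:R).
  by rewrite -E; ring.
by case: j => [[|[|[|[|[|]]]]]] // ?; rewrite /edge_diff /= -/C ?gE; ring.
Qed.

Lemma nonzero_residue (n v : nat) (d : 'Z_v) : v = (10 * n + 1)%N -> (0 < n)%N ->
  d != 0 -> exists2 k, (0 < k <= 5 * n)%N & d = k%:R \/ d = - k%:R.
Proof.
move=> vE n0 d0; have v1 : (1 < v)%N by lia.
have dv : (d < v)%N by rewrite -[X in (_ < X)%N](Zp_cast v1) ltn_ord.
have dE := natr_Zp d.
have dpos : (0 < d)%N by rewrite lt0n; apply: contraNneq d0 => d0; rewrite -dE d0.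
have [h|h] := leqP d (5 * n); first by exists d; [lia | left].
exists (v - d)%N; first by lia.
by right; rewrite natrB ?(ltnW dv) // pchar_Zp // sub0r opprK.
Qed.

Lemma base_blocks_family (n v : nat) (pi : {perm 'I_(n - 2)}) :
  (38 <= n)%N -> v = (10 * n + 1)%N -> difference_family (base_blocks v pi).
Proof.
move=> hn vE; split.
  by rewrite card_sum card_bool !card_ord Zp_cast; lia.
move=> d d0; have [|k hk dk] := nonzero_residue vE _ d0; first by lia.
suff [[t s] kE] : exists t, k%:R = signed_diff (base_blocks v pi) t.
  exists (t, s (+) (d != k%:R)); case: dk => dE; rewrite dE.
    by rewrite eqxx addbF.
  case: eqP => [E|_]; first by rewrite E addbF.
  rewrite addbT kE /signed_diff /=; case: s {kE} => //=.
  by rewrite opprK.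
have lit b (t : ('I_(n - 2) + bool) * 'Z_5) (e : 'Z_v) :
    edge_diff (base_blocks v pi) t.1 t.2 = (if b then - e else e) ->
    exists t, e = signed_diff (base_blocks v pi) t.
  by move=> E; exists (t, b); rewrite /signed_diff /= E; case: b {E}; rewrite ?opprK.
have c2 : (2 <= even_center n)%N by rewrite /even_center; lia.
case: (diff_cover hn hk); rewrite ?inE.
- case/or4P => [/eqP->|/eqP->|/eqP->|/orP[]/eqP->].
  + by apply: (lit false (inr true, 0)); rewrite rigid_diff.
  + by apply: (lit false (inr true, 1)); rewrite rigid_diff /= natrB //; lia.
  + by apply: (lit true (inr true, 2)); rewrite rigid_diff /= natrB // opprB.
  + by apply: (lit false (inr true, 3)); rewrite rigid_diff.
  + by apply: (lit true (inr true, 4)); rewrite rigid_diff.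
- have spec j := special_diff pi j hn vE.
  case/or4P => [/eqP->|/eqP->|/eqP->|/orP[]/eqP->].
  + by apply: (lit false (inr false, 0)); rewrite spec.
  + by apply: (lit false (inr false, 1)); rewrite spec.
  + by apply: (lit false (inr false, 2)); rewrite spec.
  + apply: (lit (~~ odd (n.+1)./2) (inr false, 3)); rewrite spec /= /gap_sign.
    by case: odd => /=; rewrite ?expr1 ?expr0 ?mulN1r ?mul1r ?opprK.
  + apply: (lit (~~ odd (n.+1)./2) (inr false, 4)); rewrite spec /= /gap_sign -natr1.
    by case: odd => /=; rewrite ?expr1 ?expr0 ?mulN1r ?mul1r ?opprK.
- case=> i; rewrite !inE => /or3P[]/eqP->.
  + by apply: (lit false (inl i, 0)); rewrite exchange_diff.
  + by apply: (lit false (inl i, 1)); rewrite exchange_diff.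
  + apply: (lit true (inl i, 2)); rewrite exchange_diff /=.
    have s1 : (0 < left_diff n i + small_diff i)%N.
      by rewrite /small_diff addn_gt0; case: ifP; rewrite ?addnS orbT.
    by rewrite (natrB _ s1) natrD; ring.
- case=> j; rewrite !inE => /orP[]/eqP->.
  (* Pair [j] is matched with the triple [pi^-1 j]. *)
  + by apply: (lit false (inl (pi^-1 j)%g, 3)); rewrite exchange_diff /= permKV.
  + apply: (lit true (inl (pi^-1 j)%g, 4)); rewrite exchange_diff /= permKV -natr1.
    by ring.
Qed.

(** In a common system, the first difference of block [i] of [pi] identifies it as a translate of
    block [i] of [pi']. Its fourth difference occurs for [pi'] in block [pi'^-1 (pi i)], so this
    index is [i]. *)
Lemma develop_base_blocks_inj (n v : nat) : (38 <= n)%N -> v = (10 * n + 1)%N ->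
  injective (fun pi : {perm 'I_(n - 2)} => develop (base_blocks v pi)).
Proof.
move=> hn vE pi pi' E.
have fam' := base_blocks_family pi' hn vE.
apply/permP => i.
have : pentagon (fun j => base_blocks v pi (inl i) j + 0) \in develop (base_blocks v pi').
  by rewrite -E; apply/imsetP; exists (inl i, 0).
case/imsetP => -[i' z] _ /= blockE.
have edge j : exists2 t, t.1.1 = i' &
    edge_diff (base_blocks v pi) (inl i) j = signed_diff (base_blocks v pi') t.
  have : [set base_blocks v pi (inl i) j + 0; base_blocks v pi (inl i) (j + 1) + 0]
      \in pentagon (fun j => base_blocks v pi' i' j + z).
    by rewrite -blockE; apply: imset_f.
  case/edge_in_shift => t ti [tE _]; exists t => //.
  by rewrite -tE /edge_diff !addr0.
have i'E : i' = inl i.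
  have [t <-] := edge 0.
  have -> : edge_diff (base_blocks v pi) (inl i) 0 =
      signed_diff (base_blocks v pi') (inl i, 0, false).
    by rewrite /signed_diff /= !exchange_diff.
  by move=> /(signed_diff_inj fam') <-.
have [t ti] := edge 3; rewrite i'E in ti.
have -> : edge_diff (base_blocks v pi) (inl i) 3 =
    signed_diff (base_blocks v pi') (inl (pi'^-1 (pi i))%g, 3, false).
  by rewrite /signed_diff /= !exchange_diff /= permKV.
move=> /(signed_diff_inj fam') tE; rewrite -tE /= in ti.
by case: ti => {2}<-; rewrite permKV.
Qed.

(** The block [inr true] does not involve [pi], so one rigid pentagon serves all the systems. *)
Lemma base_blocks_rigid (n v : nat) (pi : {perm 'I_(n - 2)}) :
  (38 <= n)%N -> v = (10 * n + 1)%N ->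
  rigid_system (nth 0 [:: 0; 1; (even_center n)%:R; 2; 5]) (develop (base_blocks v pi)).
Proof.
move=> hn vE; have fam := base_blocks_family pi hn vE.
split; last by rewrite /= !add0r.
split; first exact: develop_cycle_system.
- by move=> C z; apply: develop_translate.
- by move=> j k E; apply: (@base_block_inj _ _ _ (inr true) fam); exact: E.
- apply/imsetP; exists (inr true, 0) => //=.
  by apply: eq_imset => j /=; rewrite !addr0.
Qed.

Lemma NC_ge_factorial (n : nat) : (38 <= n)%N ->
  ((n - 2)`! <= NC (10 * n + 1) 5 * (10 * n + 1) ^ 3)%N.
Proof.
move=> hn; pose u := (10 * n - 1)%N.
have vE : u.+2 = (10 * n + 1)%N by rewrite /u; lia.
rewrite -vE -card_Sn.
rewrite -(card_imset {: {perm 'I_(n - 2)}} (develop_base_blocks_inj hn vE)).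
apply: (@rigid_systems_NC _ (nth 0 [:: 0; 1; (even_center n)%:R; 2; 5])).
move=> _ /imsetP[pi _ ->]; exact: base_blocks_rigid.
Qed.

(** * Factorial against exponential growth *)

Lemma factorial_ge_pow (a m : nat) : (a ^ m <= (m + a)`!)%N.
Proof.
elim: m => [|m IHm]; first by rewrite expn0 fact_gt0.
by rewrite expnS addSn factS leq_mul // ltnW // ltnS leq_addl.
Qed.

Lemma factorial_dominates (b : nat) : exists N, forall n, (N <= n)%N ->
  (b ^ n * (10 * n + 1) ^ 3 <= (n - 2)`!)%N.
Proof.
(* Here 16 = 8 * 2: the factor 8^n absorbs the cube, since 10n+1 <= 11 * 2^n, and 2^n absorbs the
   constant 11^3 * a^(a+2), which is at most n by the choice of the threshold. *)
pose a := (16 * b.+1)%N; exists (a + 2 + (11 ^ 3 * a ^ (a + 2)))%N => n hn.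
have -> : (n - 2 = n - (a + 2) + a)%N by lia.
apply: leq_trans (factorial_ge_pow _ _).
have a0 : (0 < a ^ (a + 2))%N by rewrite expn_gt0.
rewrite -(leq_pmul2r a0) -expnD subnK; last by lia.
have e1 : (11 ^ 3 * a ^ (a + 2) <= 2 ^ n)%N.
  by apply: leq_trans (ltnW (ltn_expl n (ltnSn 1))); lia.
have e2 : ((10 * n + 1) ^ 3 <= 11 ^ 3 * 8 ^ n)%N.
  have -> : (8 ^ n = (2 ^ n) ^ 3)%N by rewrite -expnM mulnC expnM.
  rewrite -expnMn leq_exp2r //.
  have := ltn_expl n (ltnSn 1); lia.
apply: (@leq_trans (b ^ n * (8 ^ n * 2 ^ n))%N).
  rewrite -mulnA leq_mul2l; apply/orP; right.
  apply: leq_trans (leq_mul (leqnn (8 ^ n)) e1).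
  by rewrite mulnA leq_mul2r [(8 ^ n * _)%N]mulnC e2 orbT.
by rewrite -!expnMn leq_exp2r ?/a //; lia.
Qed.

Theorem proposition5 :
  exists N : nat, forall n : nat, (1 < n)%N -> (N <= n)%N ->
    (n <> 4 %[mod 7] -> (297 / 10 : rat) ^+ n <= (NC (10 * n + 1) 5)%:R) /\
    (n = 4 %[mod 7] -> (384 / 10 : rat) ^+ n <= (NC (10 * n + 1) 5)%:R).
Proof.
(* As 39 exceeds both 29.7 and 38.4, one bound covers all residues modulo 7; 38 is the threshold of
   the construction. *)
have [N HN] := factorial_dominates 39; exists (N + 38)%N => n _ hn.
have NCge : (39 ^ n <= NC (10 * n + 1) 5)%N.
  have v0 : (0 < (10 * n + 1) ^ 3)%N by rewrite expn_gt0 addn1.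
  rewrite -(leq_pmul2r v0) (leq_trans (HN n _)) ?NC_ge_factorial //; lia.
have NCgeR : (39 : rat) ^+ n <= (NC (10 * n + 1) 5)%:R by rewrite -natrX ler_nat.
by split=> _; apply: le_trans NCgeR; apply: lerXn2r; rewrite ?nnegrE; lra.
Qed.
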